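(* Let $(x_1,x_2,x_3,x_4)$ be a quadruple of pairwise distinct finite rational points. Then $$\frac12\left[\frac{\mathrm{cr}''(x_1,x_2;x_3,x_4)}{\mathrm{cr}(x_1,x_2;x_3,x_4)}-\left(\frac{\mathrm{cr}'(x_1,x_2;x_3,x_4)}{\mathrm{cr}(x_1,x_2;x_3,x_4)}\right)^2\right]=\Phi_{13}+\Phi_{24}-\Phi_{14}-\Phi_{23},$$ where, writing $x_i=a_i/b_i$ in lowest terms with $b_i>0$ and $s_i=s_3(a_i,b_i)$, $$\Phi_{ij}=\frac{(x_i-x_j)^2}{24}-\frac18\left(\frac{b_i^{-2}-b_j^{-2}}{x_i-x_j}\right)^2-10\,\frac{s_i-s_j}{x_i-x_j}.$$
   Context: **Generalized Dedekind sum.** For $\{t\}$ the fractional part of $t\in\mathbb R$, let $\overline B_1(t)=\{t\}-\frac12$ if $t\notin\mathbb Z$ and $\overline B_1(t)=0$ if $t\in\mathbb Z$, and $\overline B_3(t)=B_3(\{t\})$ with $B_3(t)=t^3-\frac32t^2+\frac12t$. For coprime integers $a,b$ with $b>0$, $$s_3(a,b)=\sum_{n=1}^{b-1}\overline B_1\!\left(\tfrac nb\right)\overline B_3\!\left(\tfrac{an}{b}\right).$$ **$q$-rationals.** $[\,\cdot\,]_q:\mathbb P^1(\mathbb Q)=\mathbb Q\cup\{\infty\}\to\mathbb P^1(\mathbb Q(q))$ is the unique map with $[0]_q=0$, $[x+1]_q=q[x]_q+1$ and $[-1/x]_q=-1/(q[x]_q)$ for all $x$ (usual conventions for $\infty$;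 in particular $[\infty]_q=\infty$). For finite $x$, $[x]_q$ is a rational function of $q$, regular at $q=1$ with $[x]_1=x$. **Cross-ratios.** $\mathrm{cr}(x_1,x_2;x_3,x_4)=\frac{(x_1-x_3)(x_2-x_4)}{(x_1-x_4)(x_2-x_3)}$ and $\mathrm{cr}_q(x_1,x_2;x_3,x_4)=\mathrm{cr}([x_1]_q,[x_2]_q;[x_3]_q,[x_4]_q)\in\mathbb Q(q)$. **Taylor coefficients.** With $q=e^h$, $\mathrm{cr}_{e^h}=\mathrm{cr}+\mathrm{cr}'h+\frac{\mathrm{cr}''}{2}h^2+\cdots$ is the Taylor expansion at $h=0$. *)

(* Defs.v *)
From HB Require Import structures.
From mathcomp Require Import all_boot all_order all_algebra.
From mathcomp Require Import generic_quotient ring lra zify.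
From mathcomp Require Import all_classical all_reals all_analysis.

Set Implicit Arguments.
Unset Strict Implicit.
Unset Printing Implicit Defensive.

Import Order.TTheory GRing.Theory Num.Theory.
Local Open Scope ring_scope.

Section DedekindSum.
Variable K : archiRealFieldType.

Definition frac_part (t : K) : K := t - (Num.floor t)%:~R.

Definition B1bar (t : K) : K :=
  if t \is a Num.int then 0 else frac_part t - 1 / 2.

Definition B3 (t : K) : K := t ^+ 3 - 3 / 2 * t ^+ 2 + 1 / 2 * t.

Definition B3bar (t : K) : K := B3 (frac_part t).

End DedekindSum.

(* Meaningful for coprime a, b with 0 < b; the sum is over 1 <= n <= b - 1. *)
Definition s3 (a b : int) : rat :=
  \sum_(1 <= n < `|b|%N) B1bar (n%:R / b%:~R) * B3bar (a%:~R * n%:R / b%:~R).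

(* The projective line over a field K is [option K], with [None] for infinity.
   At q = 1 the next two maps are x |-> x + 1 and x |-> - 1 / x. *)
Section ProjectiveLine.
Variables (K : fieldType) (q : K).

Definition p1_shift (x : option K) : option K :=
  if x is Some y then Some (q * y + 1) else None.

Definition p1_neginv (x : option K) : option K :=
  if x is Some y then (if y == 0 then None else Some (- (q * y)^-1))
  else Some 0.

End ProjectiveLine.

Record q_rational_map (K : fieldType) (q : K)
    (F : option rat -> option K) : Prop := QRationalMap {
  qrat_0 : F (Some 0) = Some 0;
  qrat_shift : forall x : option rat,
    F (p1_shift 1 x) = p1_shift q (F x);
  qrat_neginv : forall x : option rat,
    F (p1_neginv 1 x) = p1_neginv q (F x)
}.

Definition Qq : fieldType := {fraction {poly rat}}.

Definition qvar : Qq := FracField.tofrac ('X : {poly rat}).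

(* Exactly one such F exists, up to pointwise equality: see
   [is_q_rational_exists] and [is_q_rational_unique]. *)
Definition is_q_rational (F : option rat -> option Qq) : Prop :=
  q_rational_map qvar F.

Definition cr (K : fieldType) (x1 x2 x3 x4 : K) : K :=
  ((x1 - x3) * (x2 - x4)) / ((x1 - x4) * (x2 - x3)).

(* The value [None] cannot occur for a finite x, by [is_q_rational_finite]. *)
Definition qrat_fin (F : option rat -> option Qq) (x : rat) : Qq :=
  odflt 0 (F (Some x)).

Definition cr_q (F : option rat -> option Qq) (x1 x2 x3 x4 : rat) : Qq :=
  cr (qrat_fin F x1) (qrat_fin F x2) (qrat_fin F x3) (qrat_fin F x4).

(* Value of a rational function at a point: the numerator and denominator are
   first made coprime, so that the result is the true value wherever the
   function is regular (see [Qq_evalE]). *)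
Definition Qq_eval (R : numFieldType) (f : Qq) (t : R) : R :=
  let n := ((frac (generic_quotient.repr f)).1 : {poly rat}) in
  let d := ((frac (generic_quotient.repr f)).2 : {poly rat}) in
  let g := gcdp n d in
  (map_poly ratr (n %/ g)).[t] / (map_poly ratr (d %/ g)).[t].

Definition cr_exp (R : realType) (F : option rat -> option Qq)
    (x1 x2 x3 x4 : rat) (h : R) : R :=
  Qq_eval (cr_q F x1 x2 x3 x4) (expR h).

(* cr^(k): k! times the coefficient of h^k in the Taylor expansion of
   cr_{e^h} at h = 0. *)
Definition cr_deriv (R : realType) (k : nat) (F : option rat -> option Qq)
    (x1 x2 x3 x4 : rat) : R :=
  derive1n k (@cr_exp R F x1 x2 x3 x4) 0.

Definition s3rat (x : rat) : rat := s3 (numq x) (denq x).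

Definition Phi (x y : rat) : rat :=
  let b (z : rat) : rat := (denq z)%:~R in
  (x - y) ^+ 2 / 24
  - 1 / 8 * (((b x) ^- 2 - (b y) ^- 2) / (x - y)) ^+ 2
  - 10 * ((s3rat x - s3rat y) / (x - y)).

Lemma frac_repr (R : idomainType) (f : {fraction R}) :
  f = FracField.tofrac ((frac (generic_quotient.repr f)).1) / FracField.tofrac ((frac (generic_quotient.repr f)).2).
Proof.
set r := generic_quotient.repr f.
have d0 : (frac r).2 != 0 by exact: denom_ratioP.
apply: (canRL (mulfK _)); first by rewrite tofrac_eq0.
have -> : f = (\pi_({fraction R}) r)%qT by rewrite reprK.
rewrite !piE; apply/eqmodP => /=.
rewrite FracField.equivfE /FracField.mulf !numden_Ratio ?mulf_neq0 ?oner_eq0 //.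
by rewrite !mulr1 mulrC.
Qed.

Lemma Qq_evalE (R : numFieldType) (n d : {poly rat}) (t : R) :
  (map_poly ratr d).[t] != 0 ->
  Qq_eval (FracField.tofrac n / FracField.tofrac d) t
  = (map_poly ratr n).[t] / (map_poly ratr d).[t].
Proof.
move=> dt0; have d0 : d != 0.
  by apply: contra_neq dt0 => ->; rewrite map_poly0 horner0.
rewrite /Qq_eval; set f := (_ / _ : Qq).
set n0 := ((frac (generic_quotient.repr f)).1 : {poly rat}); set d0' := ((frac (generic_quotient.repr f)).2 : {poly rat}).
have d0'0 : d0' != 0 by exact: denom_ratioP.
have fE : f = FracField.tofrac n0 / FracField.tofrac d0'.
  exact: frac_repr.
have eq1 : n0 * d = n * d0'.
  apply/eqP; rewrite -tofrac_eq !tofracM.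
  by rewrite -eqr_div ?tofrac_eq0 // -fE.
set g := gcdp n0 d0'.
have g0 : g != 0 by rewrite gcdp_eq0 negb_and d0'0 orbT.
set n1 := n0 %/ g; set d1 := d0' %/ g.
have n0E : n0 = n1 * g by rewrite divpK ?dvdp_gcdl.
have d0E : d0' = d1 * g by rewrite divpK ?dvdp_gcdr.
have cop : coprimep d1 n1.
  by rewrite coprimep_sym coprimep_div_gcd // d0'0 orbT.
have eq2 : n1 * d = n * d1.
  by apply: (mulIf g0); rewrite mulrAC -n0E -mulrA -d0E.
have : (d1 %| d)%R.
  by rewrite -(Gauss_dvdpr _ cop) eq2 dvdp_mull.
case/dvdpP => e dE.
have nE : n = n1 * e.
  have d10 : d1 != 0 by apply: contra_neq d0'0; rewrite d0E => ->; rewrite mul0r.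
  by apply: (mulIf d10); rewrite -eq2 dE mulrA.
move: dt0; rewrite dE nE !rmorphM !hornerM /= mulf_eq0 negb_or => /andP[e0 d10].
by field; rewrite e0 d10.
Qed.

Lemma p1_rat_ind (P : option rat -> Prop) :
  P (Some 0) -> (forall x, P x -> P (p1_shift 1 x)) ->
  (forall x, P (p1_shift 1 x) -> P x) ->
  (forall x, P x -> P (p1_neginv 1 x)) -> forall x, P x.
Proof.
move=> P0 PS PS' PN.
have Pinf : P None by exact: PN P0.
have Padd (n : int) (x : rat) : P (Some x) -> P (Some (x + n%:~R)).
  move=> Px; elim/int_ind: n => [|n IH|n IH]; first by rewrite addr0.
  - by have := PS _ IH; rewrite /= mul1r -addrA -[n.+1]addn1 PoszD intrD.
  - apply: PS'; rewrite /= mul1r -addrA (_ : _ + 1 = (- n%:Z)%:~R) //.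
    by rewrite -addn1 PoszD opprD intrD subrK.
have Pdiv (b : nat) : forall a : int, (0 < b)%N -> P (Some (a%:~R / b%:R)).
  elim/ltn_ind: b => b IH a b0.
  have bn0 : (b%:R : rat) != 0 by rewrite pnatr_eq0 -lt0n.
  set r := `|(a %% b)%Z|%N.
  have rE : (a %% b)%Z = r by rewrite /r gez0_abs // modz_ge0 // ; lia.
  have rb : (r < b)%N by rewrite -ltz_nat -rE ltz_pmod.
  have -> : (a%:~R / b%:R : rat) = r%:R / b%:R + ((a %/ b)%Z)%:~R.
    by rewrite {1}(divz_eq a b) rE intrD intrM mulrDl mulfK // addrC.
  apply: Padd; case: (posnP r) => [->|r0]; first by rewrite mul0r.
  have rn0 : (r%:R : rat) != 0 by rewrite pnatr_eq0 -lt0n.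
  have := PN _ (IH r rb (- (b : int)) r0).
  rewrite /= mulf_eq0 invr_eq0 (negPf rn0) orbF intr_eq0.
  rewrite oppr_eq0 -[_ == 0]/(b == 0%N) eqn0Ngt b0 /=.
  congr (P (Some _)); rewrite mulrNz; field; exact/andP.
case=> [x|//]; rewrite -(divq_num_den x).
have := Pdiv `|denq x|%N (numq x); rewrite absz_gt0 denq_neq0 => /(_ isT).
by rewrite pmulrn gez0_abs // denq_ge0.
Qed.

Section UnshiftAndRelation.
Variables (K : fieldType) (q : K).
Hypothesis q0 : q != 0.

Definition p1_unshift (x : option K) : option K :=
  if x is Some y then Some ((y - 1) / q) else None.

Lemma p1_shiftK : cancel (p1_shift q) p1_unshift.
Proof. by case=> //= y; congr Some; field. Qed.

Lemma p1_unshiftK : cancel p1_unshift (p1_shift q).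
Proof. by case=> //= y; congr Some; field. Qed.

Lemma p1_neginvK : involutive (p1_neginv q).
Proof.
case=> [y|] /=; last by rewrite eqxx.
case: eqVneq => [->|y0] //=; rewrite oppr_eq0 invr_eq0 mulf_eq0.
rewrite (negPf q0) (negPf y0) /=; congr Some; field.
by rewrite y0 q0 oppr_eq0 oner_eq0.
Qed.

Lemma p1_relation (x : option K) :
  p1_unshift (p1_neginv q (p1_unshift (p1_neginv q x)))
  = p1_neginv q (p1_shift q x).
Proof.
case: x => [y|] /=; last first.
  rewrite mulf_eq0 invr_eq0 (negPf q0) orbF sub0r oppr_eq0 oner_eq0 /=.
  by congr Some; field; rewrite oppr_eq0 oner_eq0 andbT.
case: (eqVneq y 0) => [->|y0] /=.
  rewrite mulr0 !add0r oner_eq0 /=; congr Some; field.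
  by [].
rewrite mulf_eq0 invr_eq0 (negPf q0) orbF subr_eq0.
have -> : (- (q * y)^-1 == 1) = (q * y + 1 == 0).
  rewrite addr_eq0 eqr_oppLR; apply/eqP/eqP => [|->]; last by rewrite invrN1.
  by move/(congr1 (@GRing.inv K)); rewrite invrK invrN invr1.
case: eqVneq => // h /=; congr Some; field.
by rewrite h y0 q0 /= mulN1r -opprD oppr_eq0 addrC.
Qed.

End UnshiftAndRelation.

Lemma q_rational_map_unique (K : fieldType) (q : K) F G : q != 0 ->
  q_rational_map q F -> q_rational_map q G -> F =1 G.
Proof.
move=> q0 [F0 FS FN] [G0 GS GN]; apply: p1_rat_ind => [|x e|x|x e].
- by rewrite F0 G0.
- by rewrite FS GS e.
- by rewrite FS GS; exact: (can_inj (p1_shiftK q0)).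
- by rewrite FN GN e.
Qed.

Section Existence.
Variables (K : fieldType) (q : K).
Hypothesis q0 : q != 0.

Definition p1_shiftz (n : int) : option K -> option K :=
  match n with
  | Posz m => iter m (p1_shift q)
  | Negz m => iter m.+1 (p1_unshift q)
  end.

Lemma p1_shiftzS n x : p1_shiftz (n + 1) x = p1_shift q (p1_shiftz n x).
Proof.
case: n => [n|[|n]].
- by rewrite -PoszD addn1.
- by rewrite /= p1_unshiftK.
- by rewrite (_ : Negz n.+1 + 1 = Negz n); [rewrite /= p1_unshiftK | lia].
Qed.

Fixpoint qrat_rec (fuel : nat) (x : rat) : option K :=
  if fuel is k.+1 then
    let r := frac_part x in
    p1_shiftz (Num.floor x)
      (p1_neginv q (if r == 0 then None else qrat_rec k (- r^-1)))
  else None.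

Definition qrat (x : option rat) : option K :=
  if x is Some y then qrat_rec `|denq y|%N y else None.

Lemma frac_part_div (a : int) (b : nat) : (0 < b)%N ->
  frac_part (a%:~R / b%:R : rat) = (`|(a %% b)%Z|%N)%:R / b%:R.
Proof.
move=> b0; have bn0 : (b%:R : rat) != 0 by rewrite pnatr_eq0 -lt0n.
have bp : (0 < b%:R :> rat) by rewrite ltr0n.
set r := `|(a %% b)%Z|%N.
have rE : (a %% b)%Z = r by rewrite /r gez0_abs // modz_ge0 //; lia.
have rb : (r < b)%N by rewrite -ltz_nat -rE ltz_pmod.
have e : (a%:~R / b%:R : rat) = r%:R / b%:R + ((a %/ b)%Z)%:~R.
  by rewrite {1}(divz_eq a b) rE intrD intrM mulrDl mulfK // addrC.
rewrite /frac_part (_ : Num.floor _ = (a %/ b)%Z) ?e ?addrK //.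
apply: floor_def; rewrite intrD ler_wpDl ?divr_ge0 ?ler0n //=.
by rewrite addrC ltrD2l ltr_pdivrMr // mul1r ltr_nat.
Qed.

Lemma qrat_rec_stable n m (a : int) (b : nat) : (0 < b <= n)%N -> (b <= m)%N ->
  qrat_rec n (a%:~R / b%:R) = qrat_rec m (a%:~R / b%:R).
Proof.
elim: n m a b => [|n IH] [|m] a b; [lia|lia|lia|].
move=> /andP[b0 bn] bm /=; congr (p1_shiftz _ (p1_neginv q _)).
rewrite frac_part_div //; set r := `|_|%N.
have rb : (r < b)%N by rewrite /r -ltz_nat gez0_abs ?ltz_pmod // modz_ge0; lia.
rewrite mulf_eq0 invr_eq0 !pnatr_eq0; case: (posnP r) => //= r0.
rewrite invf_div -mulNr.
have -> : - b%:R = (- (b : int))%:~R :> rat by rewrite mulrNz.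
by rewrite eqn0Ngt b0 /=; apply: IH; lia.
Qed.

Lemma qratE (x : rat) :
  qrat (Some x)
  = p1_shiftz (Num.floor x) (p1_neginv q (qrat (p1_neginv 1 (Some (frac_part x))))).
Proof.
have recE (y : rat) (n : nat) (a : int) (b : nat) :
    (0 < b <= n)%N -> y = a%:~R / b%:R -> qrat (Some y) = qrat_rec n y.
  move=> bn yE.
  have [d0 dE] : (0 < `|denq y|%N)%N /\ y = (numq y)%:~R / (`|denq y|%N)%:R.
    by rewrite absz_gt0 denq_neq0 pmulrn gez0_abs ?denq_ge0 // divq_num_den.
  rewrite /= {2}dE (qrat_rec_stable (m := maxn `|denq y|%N n)); [|lia..].
  by rewrite -dE yE; symmetry; apply: qrat_rec_stable; lia.
set b := `|denq x|%N.
have [b0 xE] : (0 < b)%N /\ x = (numq x)%:~R / b%:R.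
  by rewrite /b absz_gt0 denq_neq0 pmulrn gez0_abs ?denq_ge0 // divq_num_den.
rewrite [in LHS]/= -/b -(prednK b0) /=; congr (p1_shiftz _ (p1_neginv q _)).
case: eqVneq => // fr0; rewrite mul1r.
have := frac_part_div (numq x) b0; rewrite -xE => frE.
move: fr0; rewrite frE; set r := `|_|%N => fr0.
have rb : (r < b)%N by rewrite /r -ltz_nat gez0_abs ?ltz_pmod // modz_ge0; lia.
have r0 : (0 < r)%N by rewrite lt0n; apply: contra_neq fr0 => ->; rewrite mul0r.
symmetry; apply: (recE _ _ (- (b : int)) r); first lia.
by rewrite invf_div mulrNz mulNr.
Qed.

Lemma qrat_shiftP (x : option rat) : qrat (p1_shift 1 x) = p1_shift q (qrat x).
Proof.
case: x => // x; rewrite [p1_shift 1 _]/= mul1r !qratE.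
have fE : Num.floor (x + 1) = Num.floor x + 1.
  by rewrite floorDrz ?rpred1 // floor1.
have rE : frac_part (x + 1) = frac_part x.
  by rewrite /frac_part fE intrD opprD addrACA subrr addr0.
by rewrite rE fE p1_shiftzS.
Qed.

Lemma qrat_unshift (x : rat) : qrat (Some (x - 1)) = p1_unshift q (qrat (Some x)).
Proof.
have := qrat_shiftP (Some (x - 1)); rewrite /= mul1r subrK => ->.
by rewrite (p1_shiftK q0).
Qed.

Lemma qrat_neginvP (x : option rat) : qrat (p1_neginv 1 x) = p1_neginv q (qrat x).
Proof.
have o0 : (1 : rat) != 0 by rewrite oner_eq0.
pose A (y : option rat) := qrat (p1_neginv 1 y) = p1_neginv q (qrat y).
have AN y : A y -> A (p1_neginv 1 y).
  by rewrite /A (p1_neginvK o0) => ->; rewrite (p1_neginvK q0).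
have A01 (y : rat) : 0 <= y < 1 -> A (Some y).
  move=> y01; have f0 : Num.floor y = 0 by apply: floor_def.
  rewrite /A [in RHS]qratE f0 /frac_part f0 subr0.
  by rewrite (p1_neginvK q0).
have Apos (n : nat) (y : rat) : 0 <= y < n%:R + 1 -> A (Some y).
  elim: n y => [|n IH] y; first by rewrite add0r; exact: A01.
  case: (ltP y 1) => [y1 /andP[y0 _]|y1 /andP[_ yn]]; first by apply: A01; rewrite y0.
  have Az : A (Some (y - 1)) by apply: IH; move: yn; rewrite -natr1; lra.
  have yE : Some y = p1_shift 1 (Some (y - 1)) by rewrite /= mul1r subrK.
  have yn0 : y != 0 by lra.
  rewrite /A [in RHS]yE qrat_shiftP -(p1_relation q0) -Az.
  have -> : p1_neginv 1 (Some y) = Some ((y - 1) / y - 1).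
    by rewrite /= (negPf yn0) mul1r; congr Some; field.
  rewrite qrat_unshift; congr p1_unshift.
  have : A (Some ((y - 1) / y)).
    by apply: A01; rewrite divr_ge0 ?ltr_pdivrMr; lra.
  move=> /(congr1 (p1_neginv q)); rewrite (p1_neginvK q0) => <-.
  congr p1_neginv; rewrite /= mulf_eq0 invr_eq0 (negPf yn0) orbF.
  case: eqVneq => // y10; rewrite -qrat_unshift; congr (qrat (Some _)).
  by rewrite !mul1r; field; rewrite yn0 y10.
have Ann (y : rat) : 0 <= y -> A (Some y).
  move=> y0; apply: (Apos (Num.truncn y)).
  by rewrite y0 /= natr1 truncnS_gt.
have Ainf : A None by exact: (AN (Some 0) (Ann 0 (lexx _))).
case: x => // y; case: (leP 0 y) => [|y0]; first exact: Ann.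
rewrite -[Some y](p1_neginvK o0); apply: AN; rewrite /= lt_eqF //.
by apply: Ann; rewrite mul1r oppr_ge0 invr_le0 ltW.
Qed.

Lemma q_rational_map_exists : exists F, q_rational_map q F.
Proof.
exists qrat; split; [|exact: qrat_shiftP|exact: qrat_neginvP].
by rewrite -[Some 0](p1_neginvK (oner_neq0 rat)) qrat_neginvP /=.
Qed.

End Existence.

Lemma qvar_neq0 : qvar != 0.
Proof. by rewrite tofrac_eq0 polyX_eq0. Qed.

Lemma is_q_rational_exists : exists F, is_q_rational F.
Proof. exact: (q_rational_map_exists qvar_neq0). Qed.

Lemma is_q_rational_unique F G : is_q_rational F -> is_q_rational G -> F =1 G.
Proof. exact: (q_rational_map_unique qvar_neq0). Qed.

Definition p1_ratio (K : fieldType) (n d : K) : option K :=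
  if d == 0 then None else Some (n / d).

Lemma p1_ratio_shift (K : fieldType) (q n d : K) :
  p1_shift q (p1_ratio n d) = p1_ratio (q * n + d) d.
Proof.
by rewrite /p1_ratio; case: eqVneq => //= d0; congr Some; field.
Qed.

Lemma p1_ratio_unshift (K : fieldType) (q n d : K) : q != 0 ->
  p1_unshift q (p1_ratio n d) = p1_ratio (n - d) (q * d).
Proof.
move=> q0; rewrite /p1_ratio mulf_eq0 (negPf q0) /=.
by case: eqVneq => //= d0; congr Some; field; rewrite d0 q0.
Qed.

Lemma p1_ratio_neginv (K : fieldType) (q n d : K) : q != 0 ->
  (n != 0) || (d != 0) ->
  p1_neginv q (p1_ratio n d) = p1_ratio (- d) (q * n).
Proof.
move=> q0 nd; rewrite /p1_ratio mulf_eq0 (negPf q0) /=.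
case: (eqVneq d 0) nd => [->|d0] /=.
  by rewrite orbF => /negPf->; rewrite oppr0 mul0r.
move=> _; rewrite mulf_eq0 invr_eq0 (negPf d0) orbF.
by case: eqVneq => // n0; congr Some; field; rewrite d0 n0 q0.
Qed.

(* At q = 1 a q-rational specializes to the rational itself. *)
Lemma is_q_rational_value F : is_q_rational F ->
  forall x, exists n d : {poly rat}, [/\ (n.[1] != 0) || (d.[1] != 0),
    x = p1_ratio n.[1] d.[1] &
    F x = p1_ratio (FracField.tofrac n : Qq) (FracField.tofrac d)].
Proof.
move=> [F0 FS FN]; have o0 := oner_neq0 rat; have q0 := qvar_neq0.
apply: p1_rat_ind => [|x|x|x].
- exists 0, 1; rewrite hornerC hornerC oner_eq0 orbT.
  by rewrite /p1_ratio F0 !rmorph0 rmorph1 !oner_eq0 !mul0r.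
- move=> [n [d [nd xE FE]]]; exists ('X * n + d), d; split.
  + rewrite hornerD hornerM hornerX mul1r.
    by case: (eqVneq d.[1] 0) nd => [->|]; rewrite ?orbT // addr0.
  + by rewrite xE p1_ratio_shift hornerD hornerM hornerX.
  + by rewrite FS FE p1_ratio_shift rmorphD rmorphM.
- move=> [n [d [nd xE FE]]]; exists (n - d), ('X * d); split.
  + rewrite !hornerE ?mul1r.
    by case: (eqVneq d.[1] 0) nd => [->|]; rewrite ?orbT // subr0.
  + by rewrite -[x](p1_shiftK o0) xE p1_ratio_unshift // !hornerE.
  + by rewrite -[F x](p1_shiftK q0) -FS FE p1_ratio_unshift // rmorphB rmorphM.
- move=> [n [d [nd xE FE]]]; exists (- d), ('X * n).
  have nd' : (FracField.tofrac n != 0) || (FracField.tofrac d != 0).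
    rewrite !tofrac_eq0 -negb_and; apply: contraL nd => /andP[/eqP-> /eqP->].
    by rewrite horner0 eqxx.
  split; first by rewrite !hornerE ?mul1r oppr_eq0 orbC.
    by rewrite xE (p1_ratio_neginv o0 nd) !hornerE.
  by rewrite FN FE p1_ratio_neginv // rmorphN rmorphM.
Qed.

Lemma is_q_rational_finite F (x : rat) : is_q_rational F -> F (Some x) != None.
Proof.
move=> /is_q_rational_value/(_ (Some x)) [n [d [_ xE ->]]].
move: xE; rewrite /p1_ratio tofrac_eq0; case: eqVneq => // d1 _.
by case: (eqVneq d 0) d1 => // ->; rewrite horner0 eqxx.
Qed.

(* Main.v *)
(* Write [x]_{e^h} = x + u(x) h + v(x) h^2/2 + ....  The rules for x + 1 and
   -1/x determine u and v, and with b the denominator of x they are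
     u = (x^2 - x + 1 - b^-2) / 2,
     v = x^3/3 - x^2/2 + 7x/6 - 1/2 - x b^-2 + b^-2/2 - 20 s_3(x);
   compatibility of v with x |-> -1/x is exactly the reciprocity law of s_3.
   That law follows by summing, over u = i/b and v = j/a with w = {u + v}, a
   polynomial identity which expresses B_3(w) (B_1(u) + B_1(v)) by B_4(w) and
   products of Bernoulli polynomials of u and of v alone, and by using the
   multiplication formula of Bernoulli polynomials.
   The left-hand side of the theorem is half the second logarithmic derivative
   of the cross-ratio, hence an alternating sum of the terms
     (v_i - v_j) / (x_i - x_j) - ((u_i - u_j) / (x_i - x_j))^2,
   and half such a term is Phi_ij up to functions of x_i or x_j alone, which
   cancel. *)
Require Import Defs.
From mathcomp Require Import all_boot all_order all_algebra.
From mathcomp Require Import ring lra zify.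
From mathcomp Require Import all_classical all_reals all_analysis.

Set Implicit Arguments.
Unset Strict Implicit.
Unset Printing Implicit Defensive.

Import Order.TTheory GRing.Theory Num.Theory.
Import numFieldNormedType.Exports.
Local Open Scope ring_scope.

(** * Fractional parts and sums over equally spaced points *)

Section FractionalPart.
Variable K : archiRealFieldType.
Implicit Types t y : K.

Lemma frac_part_ge0_lt1 t : 0 <= frac_part t < 1.
Proof.
by have := floor_itv t; rewrite /frac_part subr_ge0 ltrBlDr addrC intrD.
Qed.

Lemma frac_part_id t : 0 <= t < 1 -> frac_part t = t.
Proof. by move=> t01; rewrite /frac_part (@floor_def _ t 0) ?subr0. Qed.

Lemma frac_partDz t (n : int) : frac_part (t + n%:~R) = frac_part t.
Proof.
by rewrite /frac_part floorDrz ?rpred_int // intrKfloor intrD; ring.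
Qed.

Lemma periodic_frac_part (T : Type) (g : K -> T) :
  (forall t, g (t + 1) = g t) -> forall t, g t = g (frac_part t).
Proof.
move=> gP t; rewrite -{1}[t](subrK (Num.floor t)%:~R) -/(frac_part t).
elim/int_ind: (Num.floor t) => [|n IH|n IH]; first by rewrite addr0.
- by rewrite intS [1 + _]addrC intrD addrA gP.
- by rewrite -gP -addrA -addn1 PoszD opprD intrD subrK.
Qed.

(** Replacing y by y + 1 permutes the terms cyclically, the last one wrapping around by periodicity
    of g; hence the sum is 1-periodic in y. *)
Lemma sum_periodic (g : K -> K) (a : nat) y : (0 < a)%N ->
  (forall t, g (t + 1) = g t) ->
  \sum_(j < a) g ((y + j%:R) / a%:R)
  = \sum_(j < a) g ((frac_part y + j%:R) / a%:R).
Proof.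
move=> a0 gP; move: y.
apply: (@periodic_frac_part _ (fun y => \sum_(j < a) g ((y + j%:R) / a%:R))).
move=> y; case: a a0 => // n _.
have n0 : (n.+1%:R : K) != 0 by rewrite pnatr_eq0.
rewrite big_ord_recr [RHS]big_ord_recl [LHS]addrC; congr (_ + _) => /=.
  by rewrite -[RHS]gP -natr1; congr g; field; rewrite natr1.
by apply: eq_bigr => j _; congr g; rewrite /bump /= -!natr1; field; rewrite natr1.
Qed.

(** Carries a multiplication formula from f to its periodization: once n y is reduced to r in [0,
    1), the points (r + j) / n already lie in [0, 1). *)
Lemma sum_frac_part_raabe (f : K -> K) (n : nat) (c y : K) : (0 < n)%N ->
  (forall t, \sum_(j < n) f ((t + j%:R) / n%:R) = f t / c) ->
  \sum_(j < n) f (frac_part (y + j%:R / n%:R)) = f (frac_part (n%:R * y)) / c.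
Proof.
move=> n_gt0 fR; have n0 : (n%:R : K) != 0 by rewrite pnatr_eq0 -lt0n.
rewrite -fR; transitivity
    (\sum_(j < n) f (frac_part ((n%:R * y + j%:R) / n%:R))).
  by apply: eq_bigr => j _; congr (f (frac_part _)); field.
rewrite (sum_periodic (g := f \o @frac_part K)) //= => [|t]; last first.
  by rewrite (frac_partDz _ 1).
apply: eq_bigr => j _; rewrite frac_part_id //.
have /andP[r0 r1] := frac_part_ge0_lt1 (n%:R * y).
apply/andP; split; first by apply: divr_ge0 => //; apply: addr_ge0.
rewrite ltr_pdivrMr ?ltr0n // mul1r.
apply: (@lt_le_trans _ _ (1 + j%:R)); first by rewrite ltrD2r.
by rewrite addrC natr1 ler_nat.
Qed.

End FractionalPart.

(** * Bernoulli polynomials: multiplication formulas, three-term identity, parity *)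

Section Bernoulli.
Variable K : archiRealFieldType.
Implicit Types t y u v : K.

Definition B2 t : K := t ^+ 2 - t + 1 / 6.
Definition B4 t : K := t ^+ 4 - 2 * t ^+ 3 + t ^+ 2 - 1 / 30.
Definition B5 t : K := t ^+ 5 - 5 / 2 * t ^+ 4 + 5 / 3 * t ^+ 3 - 1 / 6 * t.

Lemma B2_raabe (a : nat) y : (0 < a)%N ->
  \sum_(j < a) B2 ((y + j%:R) / a%:R) = B2 y / a%:R.
Proof.
rewrite lt0n => a0; have {a0} : (a%:R : K) != 0 by rewrite pnatr_eq0.
set c : K := a%:R => c0.
(* The number n of terms is separated from c to allow induction. The closed form expands B_2(t/c) in
   powers of t and telescopes each by B_k(t+1) - B_k(t) = k t^(k-1); the next two lemmas proceed
   likewise. *)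
have -> n : \sum_(j < n) B2 ((y + j%:R) / c) =
    (B3 (y + n%:R) - B3 y) / (3 * c ^+ 2)
    - (B2 (y + n%:R) - B2 y) / (2 * c) + n%:R / 6.
  elim: n => [|n IH]; first by rewrite big_ord0 addr0 !subrr !mul0r subrr addr0.
  by rewrite big_ord_recr /= {}IH -natr1 /B2 /B3; field.
by rewrite -/c /B2 /B3; field.
Qed.

Lemma B3_raabe (a : nat) y : (0 < a)%N ->
  \sum_(j < a) B3 ((y + j%:R) / a%:R) = B3 y / a%:R ^+ 2.
Proof.
rewrite lt0n => a0; have {a0} : (a%:R : K) != 0 by rewrite pnatr_eq0.
set c : K := a%:R => c0.
have -> n : \sum_(j < n) B3 ((y + j%:R) / c) =
    (B4 (y + n%:R) - B4 y) / (4 * c ^+ 3)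
    - (B3 (y + n%:R) - B3 y) / (2 * c ^+ 2)
    + (B2 (y + n%:R) - B2 y) / (4 * c).
  elim: n => [|n IH]; first by rewrite big_ord0 addr0 !subrr !mul0r subrr addr0.
  by rewrite big_ord_recr /= {}IH -natr1 /B2 /B3 /B4; field.
by rewrite -/c /B2 /B3 /B4; field.
Qed.

Lemma B4_raabe (a : nat) y : (0 < a)%N ->
  \sum_(j < a) B4 ((y + j%:R) / a%:R) = B4 y / a%:R ^+ 3.
Proof.
rewrite lt0n => a0; have {a0} : (a%:R : K) != 0 by rewrite pnatr_eq0.
set c : K := a%:R => c0.
have -> n : \sum_(j < n) B4 ((y + j%:R) / c) =
    (B5 (y + n%:R) - B5 y) / (5 * c ^+ 4)
    - (B4 (y + n%:R) - B4 y) / (2 * c ^+ 3)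
    + (B3 (y + n%:R) - B3 y) / (3 * c ^+ 2) - n%:R / 30.
  elim: n => [|n IH].
    by rewrite big_ord0 addr0 !subrr !mul0r subrr addr0 subrr.
  by rewrite big_ord_recr /= {}IH -natr1 /B3 /B4 /B5; field.
by rewrite -/c /B3 /B4 /B5; field.
Qed.

(* Specialization of the three-term relation between the generating functions
   e^(s {u}) / (e^s - 1), in which all mixed terms other than those of the two
   Dedekind sums have been eliminated. *)
Lemma bernoulli_three_term u v : 0 <= u < 1 -> 0 <= v < 1 ->
  let w := frac_part (u + v) in
  B3 w * ((u - 1 / 2) + (v - 1 / 2))
  = 3 / 4 * B4 w + 1 / 4 * (B4 u + B4 v) + 3 / 2 * (B2 u * B2 v)
    + B3 u * (v - 1 / 2) + (u - 1 / 2) * B3 v.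
Proof.
move=> /andP[u0 u1] /andP[v0 v1] w.
have [uv1|uv1] := ltP (u + v) 1.
  have -> : w = u + v by apply: frac_part_id; rewrite addr_ge0.
  by rewrite /B2 /B3 /B4; field.
have -> : w = u + v - 1.
  rewrite /w -[u + v](subrK 1) (@frac_partDz _ _ 1) frac_part_id ?subrK //.
  by lra.
by rewrite /B2 /B3 /B4; field.
Qed.

Lemma B3bar_periodic t : B3bar (t + 1) = B3bar t.
Proof. by rewrite /B3bar (@frac_partDz _ _ 1). Qed.

Lemma B3bar_int (n : int) : B3bar (n%:~R : K) = 0.
Proof.
rewrite /B3bar -[n%:~R]add0r frac_partDz frac_part_id ?lexx ?ltr01 //.
by rewrite /B3; field.
Qed.

(** Follows from B_3(1 - t) = - B_3(t); integers are treated apart, since there {-t} is 0 and not 1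
    - {t}. *)
Lemma B3barN t : B3bar (- t) = - B3bar t.
Proof.
have [f0 f1] := andP (frac_part_ge0_lt1 t).
have tE : t = frac_part t + (Num.floor t)%:~R by rewrite subrK.
have [f00|fn0] := eqVneq (frac_part t) 0.
  by rewrite tE f00 add0r -mulrNz !B3bar_int oppr0.
have -> : B3bar (- t) = B3 (1 - frac_part t).
  rewrite /B3bar {1}tE -[1 - frac_part t]frac_part_id; last first.
    by have : 0 < frac_part t; [rewrite lt_def fn0 | lra].
  rewrite -(frac_partDz (1 - _) (- Num.floor t - 1)); congr (B3 (frac_part _)).
  by rewrite intrD !mulrNz; ring.
by rewrite /B3bar /B3; field.
Qed.

End Bernoulli.

(** * The Dedekind sum s_3 and its reciprocity law *)

Section Reciprocity.

(** The index 0 can be included with the factor -1/2 instead of [B1bar] 0 = 0, because [B3bar]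
    vanishes at 0. *)
Lemma s3E (a : int) (b : nat) : (0 < b)%N ->
  s3 a b = \sum_(i < b) (i%:R / b%:R - 1 / 2) * B3bar (a%:~R * (i%:R / b%:R)).
Proof.
move=> b0; have bn0 : (0 < b%:R :> rat) by rewrite ltr0n.
rewrite /s3 -[RHS](big_mkord xpredT (fun i : nat =>
  (i%:R / b%:R - 1 / 2) * B3bar (a%:~R * (i%:R / b%:R) : rat))).
rewrite [RHS]big_ltn // mul0r mulr0 (B3bar_int _ 0) mulr0 add0r absz_nat.
apply: eq_big_nat => i /andP[i0 ib]; rewrite mulrA; congr (_ * _).
have i01 : 0 < (i%:R / b%:R : rat) < 1.
  by rewrite divr_gt0 ?ltr0n // ltr_pdivrMr // mul1r ltr_nat.
rewrite /B1bar -pmulrn frac_part_id; last by case/andP: i01 => /ltW-> ->.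
rewrite ifN // intrEfloor (@floor_def _ _ 0); first by case/andP: i01 => /lt_eqF->.
by case/andP: i01 => /ltW-> ->.
Qed.

Lemma s3N (a b : int) : s3 (- a) b = - s3 a b.
Proof.
rewrite /s3 -sumrN; apply: eq_bigr => i _.
by rewrite mulrNz !mulNr B3barN mulrN.
Qed.

Lemma s3D (a n : int) (b : nat) : (0 < b)%N -> s3 (a + n * b) b = s3 a b.
Proof.
move=> b0; rewrite !s3E //; apply: eq_bigr => i _; congr (_ * B3 _).
have bn0 : (b%:R : rat) != 0 by rewrite pnatr_eq0 -lt0n.
rewrite -[RHS](frac_partDz _ (n * i)); congr frac_part.
by rewrite !intrD !intrM -!pmulrn; field.
Qed.

Lemma s3rat_div (a : int) (b : nat) : (0 < b)%N -> coprime `|a| b ->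
  s3rat (a%:~R / b%:R) = s3 a b /\ denq (a%:~R / b%:R) = b.
Proof.
move=> b0 co; have bn0 : b != 0 :> int by rewrite eqz_nat -lt0n.
rewrite /s3rat -[b%:R]/(b%:~R) coprimeq_num // coprimeq_den //.
by rewrite gtr0_sg ?ltz_nat // mul1r eqz_nat eqn0Ngt b0.
Qed.

Lemma s3ratDz (x : rat) (n : int) : s3rat (x + n%:~R) = s3rat x
  /\ denq (x + n%:~R) = denq x.
Proof.
have [d dE] : exists d : nat, denq x = d by exists `|denq x|%N; rewrite gez0_abs.
have d0 : (0 < d)%N by rewrite -ltz_nat -dE denq_gt0.
have dn0 : (d%:R : rat) != 0 by rewrite pnatr_eq0 -lt0n.
have -> : x + n%:~R = (numq x + n * d)%:~R / d%:R.
  by rewrite -{1}[x]divq_num_den dE intrD intrM -!pmulrn; field.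
have [|-> ->] := s3rat_div (a := numq x + n * d) d0.
  have : coprimez d (numq x) by rewrite -dE coprimez_sym; exact: coprime_num_den.
  by rewrite /coprimez -(gcdzMDl n) -/(coprimez _ _) coprimez_sym addrC.
by rewrite s3D // /s3rat dE.
Qed.

(** Multiplication by a permutes the residues modulo b. *)
Lemma sum_frac_part_mul (g : rat -> rat) (a b : nat) : (0 < b)%N ->
  coprime a b ->
  \sum_(i < b) g (frac_part (a%:R * (i%:R / b%:R))) = \sum_(i < b) g (i%:R / b%:R).
Proof.
move=> b0 co; pose p (i : 'I_b) := Ordinal (ltn_pmod (a * i) b0).
have p_inj : injective p.
  move=> i j /(congr1 val) /= /eqP; wlog ij : i j / (j <= i)%N => [wl|].
    case/orP: (leq_total i j) => [ij|]; last exact: wl.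
    by rewrite eq_sym => /(wl _ _ ij).
  rewrite eqn_mod_dvd ?leq_mul2l ?ij ?orbT // -mulnBr Gauss_dvdr 1?coprime_sym //.
  rewrite /dvdn modn_small ?(leq_ltn_trans (leq_subr _ _)) // subn_eq0 => ji.
  by apply/val_inj/eqP; rewrite eqn_leq ji.
rewrite [RHS](reindex_inj p_inj); apply: eq_bigr => i _ /=; congr g.
rewrite mulrA -natrM -[(a * i)%:R]/((a * i)%N%:~R).
by rewrite (frac_part_div (oner_neq0 rat)) // modz_nat.
Qed.

Lemma s3_reciprocity (a b : nat) : (0 < a)%N -> (0 < b)%N -> coprime a b ->
  s3 a b / a%:R ^+ 2 + s3 b a / b%:R ^+ 2
  = - 1 / (40 * (a%:R * b%:R) ^+ 3)
    - (a%:R / b%:R ^+ 3 + b%:R / a%:R ^+ 3) / 120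
    + 1 / (24 * a%:R * b%:R).
Proof.
move=> a0 b0 co.
have an0 : (a%:R : rat) != 0 by rewrite pnatr_eq0 -lt0n.
have bn0 : (b%:R : rat) != 0 by rewrite pnatr_eq0 -lt0n.
pose u (i : 'I_b) : rat := i%:R / b%:R; pose v (j : 'I_a) : rat := j%:R / a%:R.
have itv n (i : 'I_n) : (0 <= (i%:R / n%:R : rat) < 1).
  have n0 : (0 < n)%N := leq_ltn_trans (leq0n i) (ltn_ord i).
  by rewrite divr_ge0 ?ler0n //= ltr_pdivrMr ?ltr0n // mul1r ltr_nat.
have sumB2 n : (0 < n)%N -> \sum_(i < n) B2 (i%:R / n%:R : rat) = 1 / 6 / n%:R.
  move=> n0; have := B2_raabe (0 : rat) n0.
  under eq_bigr do rewrite add0r.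
  by move=> ->; rewrite /B2; field; rewrite pnatr_eq0 -lt0n.
have sumB3 n : (0 < n)%N -> \sum_(i < n) B3 (i%:R / n%:R : rat) = 0.
  move=> n0; have := B3_raabe (0 : rat) n0.
  under eq_bigr do rewrite add0r.
  by move=> ->; rewrite /B3; field; rewrite pnatr_eq0 -lt0n.
have sumB4 n : (0 < n)%N -> \sum_(i < n) B4 (i%:R / n%:R : rat)
    = - 1 / 30 / n%:R ^+ 3.
  move=> n0; have := B4_raabe (0 : rat) n0.
  under eq_bigr do rewrite add0r.
  by move=> ->; rewrite /B4; field; rewrite pnatr_eq0 -lt0n.
have e : \sum_i \sum_j B3 (frac_part (u i + v j)) * ((u i - 1 / 2) + (v j - 1 / 2))
  = \sum_i \sum_j (3 / 4 * B4 (frac_part (u i + v j)) + 1 / 4 * (B4 (u i) + B4 (v j))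
    + 3 / 2 * (B2 (u i) * B2 (v j))
    + B3 (u i) * (v j - 1 / 2) + (u i - 1 / 2) * B3 (v j)).
  apply: eq_bigr => i _; apply: eq_bigr => j _.
  exact: bernoulli_three_term (itv _ _) (itv _ _).
(* For the factor u_i - 1/2 the sum over j gives [B3bar] (a u_i) / a^2, hence s_3(a, b) / a^2; the
   other factor is symmetric. *)
have L : \sum_i \sum_j B3 (frac_part (u i + v j)) * ((u i - 1 / 2) + (v j - 1 / 2))
    = s3 a b / a%:R ^+ 2 + s3 b a / b%:R ^+ 2.
  under eq_bigr do (under eq_bigr do rewrite mulrDr; rewrite big_split /=).
  rewrite big_split /= [X in _ + X]exchange_big /= !s3E // !mulr_suml.
  congr (_ + _); apply: eq_bigr => i _; rewrite -mulr_suml.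
    rewrite (sum_frac_part_raabe _ a0 (fun t => B3_raabe t a0)) /B3bar.
    by rewrite -[i%:R / _]/(u i) -pmulrn; field.
  under eq_bigr do rewrite addrC.
  rewrite (sum_frac_part_raabe _ b0 (fun t => B3_raabe t b0)) /B3bar.
  by rewrite -[i%:R / _]/(v i) -pmulrn; field.
have split4 n (f g h k : 'I_n -> rat) : \sum_i (f i + g i + h i + k i)
    = \sum_i f i + \sum_i g i + \sum_i h i + \sum_i k i.
  by rewrite !big_split.
rewrite -L e.
(* The sum over j is carried out first. The terms mixing B_3 with a linear factor drop out, as the
   values B_3(i/n) sum to 0. *)
transitivity (\sum_i (3 / 4 * (B4 (frac_part (a%:R * u i)) / a%:R ^+ 3)
    + 1 / 4 * (B4 (u i) * a%:R - 1 / 30 / a%:R ^+ 3)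
    + 3 / 2 * (1 / 6 / a%:R) * B2 (u i) + B3 (u i) * (\sum_j (v j - 1 / 2)))).
  apply: eq_bigr => i _; rewrite big_split split4 /= -!mulr_sumr.
  rewrite (sum_frac_part_raabe _ a0 (fun t => B4_raabe t a0)) big_split /=.
  rewrite sumB2 // sumB3 // mulr0 addr0 sumB4 // sumr_const card_ord -mulr_natr.
  ring.
rewrite split4 -!mulr_sumr -!mulr_suml (sum_frac_part_mul (@B4 rat)) //.
rewrite sumB2 // sumB3 // sumB4 // big_split /= -!mulr_suml sumB4 //.
rewrite sumr_const card_ord -mulr_natr; field.
by rewrite an0 bn0.
Qed.

End Reciprocity.

(** * The derivation q d/dq, which is d/dh for q = e^h *)

(* Locked: otherwise rewriting with [hornerM] sees through the product. *)
Definition theta (K : nzRingType) (p : {poly K}) : {poly K} :=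
  locked ('X * p^`()).

Section Theta.
Variable K : comNzRingType.
Implicit Types p q : {poly K}.

Lemma thetaE p : theta p = 'X * p^`().
Proof. by rewrite /theta -lock. Qed.

Lemma thetaC (c : K) : theta c%:P = 0.
Proof. by rewrite thetaE derivC mulr0. Qed.

Lemma thetaD p q : theta (p + q) = theta p + theta q.
Proof. by rewrite !thetaE derivD mulrDr. Qed.

Lemma thetaN p : theta (- p) = - theta p.
Proof. by rewrite !thetaE derivN mulrN. Qed.

Lemma thetaM p q : theta (p * q) = theta p * q + p * theta q.
Proof. by rewrite !thetaE derivM; ring. Qed.

Lemma thetaX : theta 'X = 'X :> {poly K}.
Proof. by rewrite !thetaE derivX mulr1. Qed.

End Theta.

(** * Second-order expansions of q-rationals at q = 1 *)

Section Jets.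

Definition inv_denq2 (x : rat) : rat := (denq x)%:~R ^- 2.

(* First and second h-derivatives of [x]_q at h = 0, for q = e^h. *)
Definition qrat_jet1 (x : rat) : rat := (x ^+ 2 - x + 1 - inv_denq2 x) / 2.

Definition qrat_jet2 (x : rat) : rat :=
  x ^+ 3 / 3 - x ^+ 2 / 2 + 7 / 6 * x - 1 / 2
  - x * inv_denq2 x + inv_denq2 x / 2 - 20 * s3rat x.

(** These are the coefficients of h and h^2/2 in e^h [x]_q + 1. *)
Lemma qrat_jetD1 (x : rat) : qrat_jet1 (x + 1) = qrat_jet1 x + x
  /\ qrat_jet2 (x + 1) = qrat_jet2 x + 2 * qrat_jet1 x + x.
Proof.
have [sE dE] : s3rat (x + 1) = s3rat x /\ denq (x + 1) = denq x := s3ratDz x 1.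
have iE : inv_denq2 (x + 1) = inv_denq2 x by rewrite /inv_denq2 dE.
by rewrite /qrat_jet2 /qrat_jet1 sE iE; split; field.
Qed.

Lemma s3ratN (x : rat) : s3rat (- x) = - s3rat x.
Proof. by rewrite /s3rat numqN denqN s3N. Qed.

Lemma inv_denq2_neginv (x : rat) : x != 0 ->
  inv_denq2 (- x^-1) = inv_denq2 x / x ^+ 2.
Proof.
move=> x0; have nx0 : numq x != 0 by rewrite numq_eq0.
have -> : - x^-1 = (- denq x)%:~R / (numq x)%:~R.
  by rewrite -{1}[x]divq_num_den invf_div mulrNz mulNr.
rewrite /inv_denq2 coprimeq_den; last by rewrite abszN coprime_sym coprime_num_den.
rewrite (negPf nx0) -{3}[x]divq_num_den.
have -> : `|numq x|%:~R ^- 2 = (numq x)%:~R ^- 2 :> rat.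
  by rewrite intr_norm real_normK ?num_real.
by rewrite expr_div_n invf_div mulKf // expf_neq0 // intr_eq0 denq_neq0.
Qed.

(** Reciprocity multiplied by b^2, for x = a/b > 0, with s_3(-b, a) = - s_3(b, a). All terms are odd
    in x, which settles negative x. *)
Lemma s3rat_neginv (x : rat) : x != 0 ->
  s3rat (- x^-1) = s3rat x / x ^+ 2 + inv_denq2 x ^+ 2 / (40 * x ^+ 3)
    + (x + x ^- 3) / 120 - 1 / (24 * x).
Proof.
wlog x0 : x / 0 < x => [wl|] xn0.
  move: (xn0); rewrite neq_lt => /orP[x0|x0]; last exact: wl.
  have := wl (- x); rewrite oppr_gt0 oppr_eq0 => /(_ x0 xn0).
  have -> : inv_denq2 (- x) = inv_denq2 x by rewrite /inv_denq2 denqN.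
  by rewrite invrN !s3ratN opprK => ->; field.
have [b bE] : exists b : nat, denq x = b by exists `|denq x|%N; rewrite gez0_abs.
have [a aE] : exists a : nat, numq x = a.
  by exists `|numq x|%N; rewrite gez0_abs // numq_ge0 ltW.
have b0 : (0 < b)%N by rewrite -ltz_nat -bE denq_gt0.
have a0 : (0 < a)%N by rewrite -ltz_nat -aE numq_gt0.
have bn0 : (b%:R : rat) != 0 by rewrite pnatr_eq0 -lt0n.
have an0 : (a%:R : rat) != 0 by rewrite pnatr_eq0 -lt0n.
have co : coprime a b by have := coprime_num_den x; rewrite aE bE.
have xE : x = a%:R / b%:R by rewrite -[x]divq_num_den aE bE.
have sE : s3rat (- x^-1) = - s3 b a.
  rewrite xE invf_div -mulNr -[- b%:R]/(- b%:~R) -mulrNz -s3N.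
  by have [|] := s3rat_div (a := - b%:Z) a0; rewrite // abszN coprime_sym.
have := s3_reciprocity a0 b0 co; rewrite sE /inv_denq2 /s3rat aE bE xE -pmulrn.
move: (s3 a b) (s3 b a) => s t; rewrite addrC => /(canRL (addrK _)).
move/(canRL (divfK (expf_neq0 _ bn0))) => ->; field.
by rewrite an0 bn0.
Qed.

(** These are the coefficients of h and h^2/2 in - e^(-h) / [x]_q; the second uses reciprocity. *)
Lemma qrat_jet_neginv (x : rat) : x != 0 ->
  qrat_jet1 (- x^-1) = x^-1 + qrat_jet1 x / x ^+ 2
  /\ qrat_jet2 (- x^-1) = - x^-1 - 2 * qrat_jet1 x / x ^+ 2
     + qrat_jet2 x / x ^+ 2 - 2 * qrat_jet1 x ^+ 2 / x ^+ 3.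
Proof.
move=> x0; rewrite /qrat_jet2 s3rat_neginv // /qrat_jet1 inv_denq2_neginv //.
by split; field.
Qed.

(* [n / d], as a function of q = e^h, has the 2-jet of [x]_q at h = 0. *)
Definition has_jets (n d : {poly rat}) (x : rat) : Prop :=
  [/\ d.[1] != 0,
      n.[1] = x * d.[1],
      (theta n).[1] = qrat_jet1 x * d.[1] + x * (theta d).[1] &
      (theta (theta n)).[1] = qrat_jet2 x * d.[1]
        + 2 * qrat_jet1 x * (theta d).[1] + x * (theta (theta d)).[1]].

Lemma qrat_jets F : is_q_rational F -> forall x, exists n d : {poly rat},
  F (Some x) = p1_ratio (FracField.tofrac n : Qq) (FracField.tofrac d)
  /\ has_jets n d x.
Proof.
move=> [F0 FS FN] x.
pose hE := (hornerD, hornerN, hornerM, hornerX).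
(* The invariant is void at infinity, so the passage from infinity to 0 by [p1_neginv] rests on
   [Q0]. *)
pose Q y := if y is Some x then exists n d : {poly rat},
  F y = p1_ratio (FracField.tofrac n : Qq) (FracField.tofrac d)
  /\ has_jets n d x else True.
have Q0 : Q (Some 0).
  exists 0%:P, 1%:P; split.
    by rewrite F0 /p1_ratio polyC0 polyC1 rmorph0 rmorph1 oner_eq0 mul0r.
  rewrite /has_jets !(thetaC, hornerC) oner_eq0.
  by rewrite /qrat_jet2 /qrat_jet1 /inv_denq2 /s3rat /s3 big_geq.
apply: (p1_rat_ind (P := Q) Q0 _ _ _ (Some x)) => [[]|[]|[]] //= {}x.
- move=> [n [d [FE [d0 e0 e1 e2]]]]; rewrite mul1r.
  have [j1 j2] := qrat_jetD1 x.
  exists ('X * n + d), d; split; last split.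
  + have -> : Some (x + 1) = p1_shift 1 (Some x) by rewrite /= mul1r.
    by rewrite FS FE p1_ratio_shift rmorphD rmorphM.
  + exact: d0.
  + by rewrite !hE e0; ring.
  + by rewrite !(thetaD, thetaM, thetaX) !hE e0 e1 j1; ring.
  + by rewrite !(thetaD, thetaM, thetaX) !hE e0 e1 e2 j1 j2; ring.
- rewrite mul1r; move=> [n [d [FE [d0 e0 e1 e2]]]].
  have [j1 j2] := qrat_jetD1 x; move: e1 e2; rewrite j1 j2 => e1 e2.
  exists (n - d), ('X * d); split; last split.
  + rewrite -[F _](p1_shiftK qvar_neq0) -FS.
    have -> : p1_shift 1 (Some x) = Some (x + 1) by rewrite /= mul1r.
    by rewrite FE (p1_ratio_unshift _ _ qvar_neq0) rmorphB rmorphM.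
  + by rewrite hornerM hornerX mul1r.
  + by rewrite !hE e0; ring.
  + by rewrite !(thetaD, thetaN, thetaM, thetaX) !hE e1; ring.
  + by rewrite !(thetaD, thetaN, thetaM, thetaX) !hE e2; ring.
- case: eqVneq => [->|x0] //= [n [d [FE [d0 e0 e1 e2]]]]; rewrite mul1r.
  have [j1 j2] := qrat_jet_neginv x0.
  have n0 : n.[1] != 0 by rewrite e0 mulf_neq0.
  exists (- d), ('X * n); split; last split.
  + have -> : Some (- x^-1) = p1_neginv 1 (Some x).
      by rewrite /= (negPf x0) mul1r.
    have nd : (FracField.tofrac n != 0) || (FracField.tofrac d != 0).
      rewrite !tofrac_eq0; apply/orP; left.
      by apply: contra_neq n0 => ->; rewrite horner0.
    by rewrite FN FE (p1_ratio_neginv qvar_neq0 nd) rmorphN rmorphM.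
  + by rewrite hornerM hornerX mul1r.
  + by rewrite !hE e0; field.
  + by rewrite !(thetaD, thetaN, thetaM, thetaX) !hE e0 e1 j1; field.
  + by rewrite !(thetaD, thetaN, thetaM, thetaX) !hE e0 e1 e2 j1 j2; field.
Qed.

End Jets.

(** * Derivatives in h of quotients of polynomials in e^h *)

Section ExpDerivatives.
Variable R : realType.
Implicit Types p n d : {poly rat}.

Definition horner_exp p (h : R) : R := (map_poly ratr p).[expR h].

Lemma is_derive_horner_exp p (h : R) :
  is_derive h 1 (horner_exp p) (horner_exp (theta p) h).
Proof.
rewrite /horner_exp thetaE rmorphM /= map_polyX hornerM hornerX -deriv_map mulrC.
exact: is_derive1_comp.
Qed.

Lemma horner_exp0 p : horner_exp p 0 = ratr p.[1].
Proof. by rewrite /horner_exp expR0 -(rmorph1 (@ratr R)) horner_map. Qed.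

Lemma horner_expM p n :
  horner_exp (p * n) = (fun h => horner_exp p h * horner_exp n h).
Proof. by apply/funext => h; rewrite /horner_exp rmorphM hornerM. Qed.

Lemma horner_exp_near0 p : p.[1] != 0 ->
  \forall h \near (0 : R), horner_exp p h != 0.
Proof.
move=> p0.
have c : {for 0, continuous (horner_exp p)}.
  apply/differentiable_continuous/derivable1_diffP.
  by case: (is_derive_horner_exp p 0).
by apply: (cvgr_neq0 _ c); rewrite horner_exp0 fmorph_eq0.
Qed.

(** Hypothesis and conclusion both hold on a neighbourhood of 0 and have the same shape, so that the
    quotient rule can be iterated. *)
Lemma derive1_quotient_exp n d (f : R -> R) : d.[1] != 0 ->
  (\forall h \near (0 : R), f h = horner_exp n h / horner_exp d h) ->
  \forall h \near (0 : R), derive1 f h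
    = horner_exp (theta n * d - n * theta d) h / horner_exp (d * d) h.
Proof.
move=> d0 fE; have dn := horner_exp_near0 d0.
(* For h near 0 the formula for f holds on a whole neighbourhood of h, as differentiation at h
   requires. *)
have /= fE' := near_join fE.
near=> h.
have dh : horner_exp d h != 0 by near: h.
rewrite derive1E.
have fg : \near h, f h = horner_exp n h / horner_exp d h by near: h.
rewrite (near_eq_derive _ fg).
have := is_deriveM (is_derive_horner_exp n h)
 (is_deriveV dh (is_derive_horner_exp d h)).
move=> [_ ->].
rewrite horner_expM /horner_exp rmorphB !rmorphM /= !hornerE -!/(horner_exp _ _).
by rewrite /GRing.scale /=; field.
Unshelve. all: by end_near. Qed.

End ExpDerivatives.

(** * Second logarithmic derivatives *)

Section LogDerivative.

(* Second h-derivative of log p(e^h) at h = 0. *)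
Definition dlog2 (p : {poly rat}) : rat :=
  (theta (theta p)).[1] / p.[1] - ((theta p).[1] / p.[1]) ^+ 2.

Lemma dlog2M (p q : {poly rat}) : p.[1] != 0 -> q.[1] != 0 ->
  dlog2 (p * q) = dlog2 p + dlog2 q.
Proof.
move=> p0 q0; rewrite /dlog2 !(thetaM, thetaD) !(hornerD, hornerM).
by field; rewrite p0 q0.
Qed.

(** The left-hand side is the expression of (log f)'' at 0, which turns the quotient into a
    difference. *)
Lemma derive2_quotient_exp (R : realType) (n d : {poly rat}) (f : R -> R) :
  n.[1] != 0 -> d.[1] != 0 ->
  (\forall h \near (0 : R), f h = horner_exp n h / horner_exp d h) ->
  derive1n 2 f 0 / f 0 - (derive1n 1 f 0 / f 0) ^+ 2 = ratr (dlog2 n - dlog2 d).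
Proof.
move=> n0 d0 f0; have f1 := derive1_quotient_exp d0 f0.
have dd0 : (d * d).[1] != 0 by rewrite hornerM mulf_neq0.
have f2 := derive1_quotient_exp dd0 f1.
rewrite derive1nS derive1n1.
rewrite (nbhs_singleton f0) (nbhs_singleton f1) (nbhs_singleton f2).
rewrite !horner_exp0 -!fmorph_div -rmorphXn -rmorphB; congr ratr.
rewrite /dlog2 !(thetaM, thetaD, thetaN) !(hornerD, hornerN, hornerM).
by field; rewrite n0 d0.
Qed.

(** Second h-derivative at 0 of log([x]_q - [y]_q), up to the sign inside the logarithm. *)
Definition jet_term (x y : rat) : rat :=
  (qrat_jet2 x - qrat_jet2 y) / (x - y)
  - ((qrat_jet1 x - qrat_jet1 y) / (x - y)) ^+ 2.

(** Half the part free of s_3 and of denominators is ((x - y)^2 + 11) / 24; the terms linear in the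
    b^-2 combine to the last summand. *)
Lemma jet_termE (x y : rat) : x != y ->
  1 / 2 * jet_term x y
  = Phi x y + 11 / 24 - (inv_denq2 x + inv_denq2 y) / 4.
Proof.
rewrite -subr_eq0 => xy.
rewrite /jet_term /Phi /qrat_jet1 /qrat_jet2 -/(inv_denq2 x) -/(inv_denq2 y).
move: (inv_denq2 x) (inv_denq2 y) (s3rat x) (s3rat y) => bx by_ sx sy.
by field; exact: xy.
Qed.

(** The polynomial is d e times n/d - m/e, so its logarithm splits into three; at q = 1 its value is
    (x - y) d(1) e(1). *)
Lemma dlog2_sub (x y : rat) (n d m e : {poly rat}) : x != y ->
  has_jets n d x -> has_jets m e y ->
  (n * e - m * d).[1] != 0 /\
  dlog2 (n * e - m * d) = dlog2 d + dlog2 e + jet_term x y.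
Proof.
rewrite -subr_eq0 => xy [d0 n0 n1 n2] [e0 m0 m1 m2]; split.
  rewrite !(hornerD, hornerN, hornerM) n0 m0.
  rewrite (_ : _ - _ = (x - y) * (d.[1] * e.[1])); last by ring.
  by rewrite !mulf_neq0.
rewrite /dlog2 /jet_term !(thetaM, thetaD, thetaN) !(hornerD, hornerN, hornerM).
rewrite n0 n1 n2 m0 m1 m2.
move: (qrat_jet1 x) (qrat_jet1 y) (qrat_jet2 x) (qrat_jet2 y) => u1 u2 v1 v2.
move: (theta (theta d)).[1] (theta (theta e)).[1] (theta d).[1] (theta e).[1].
move: d.[1] e.[1] d0 e0 => d0 e0 dn0 en0 d2 e2 d1 e1.
field; apply/and4P; split=> //.
have -> : x * d0 * e0 - y * e0 * d0 = (x - y) * (d0 * e0) by ring.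
by rewrite !mulf_neq0.
Qed.

End LogDerivative.

(** * The q-deformed cross-ratio as a quotient of polynomials *)

Lemma cr_ratio (K : fieldType) (n1 d1 n2 d2 n3 d3 n4 d4 : K) :
  d1 != 0 -> d2 != 0 -> d3 != 0 -> d4 != 0 ->
  cr (n1 / d1) (n2 / d2) (n3 / d3) (n4 / d4)
  = ((n1 * d3 - n3 * d1) * (n2 * d4 - n4 * d2))
    / ((n1 * d4 - n4 * d1) * (n2 * d3 - n3 * d2)).
Proof.
move=> h1 h2 h3 h4.
have sub (n d m e : K) : d != 0 -> e != 0 ->
  n / d - m / e = (n * e - m * d) / (d * e).
  by move=> d0 e0; field; rewrite d0 e0.
rewrite /cr !sub // !mulf_div invf_div mulf_div.
(* Every d_i enters once above and once below, so the denominators cancel. *)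
have -> : d1 * d4 * (d2 * d3) = d1 * d3 * (d2 * d4) by ring.
by rewrite [X in X / _]mulrC -[LHS]mulf_div divff ?mul1r // !mulf_neq0.
Qed.

Theorem theorem1p7 (R : realType) (F : option rat -> option Qq)
    (hF : is_q_rational F) (x1 x2 x3 x4 : rat)
    (hx : uniq [:: x1; x2; x3; x4]) :
  let c0 : R := ratr (cr x1 x2 x3 x4) in
  let c1 : R := cr_deriv R 1 F x1 x2 x3 x4 in
  let c2 : R := cr_deriv R 2 F x1 x2 x3 x4 in
  1 / 2 * (c2 / c0 - (c1 / c0) ^+ 2)
  = ratr (Phi x1 x3 + Phi x2 x4 - Phi x1 x4 - Phi x2 x3).
Proof.
have [x12 x13 x14 [x23 x24 x34]] : [/\ x1 != x2, x1 != x3, x1 != x4 &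
  [/\ x2 != x3, x2 != x4 & x3 != x4]].
  move: hx; rewrite /= !inE !negb_or andbT.
  by case/and3P=> /and3P[-> -> ->] /andP[-> ->] ->.
have [n1 [d1 [FE1 J1]]] := qrat_jets hF x1.
have [n2 [d2 [FE2 J2]]] := qrat_jets hF x2.
have [n3 [d3 [FE3 J3]]] := qrat_jets hF x3.
have [n4 [d4 [FE4 J4]]] := qrat_jets hF x4.
have [p13 l13] := dlog2_sub x13 J1 J3.
have [p24 l24] := dlog2_sub x24 J2 J4.
have [p14 l14] := dlog2_sub x14 J1 J4.
have [p23 l23] := dlog2_sub x23 J2 J3.
have [[d10 a1 _ _] [d20 a2 _ _]] := (J1, J2).
have [[d30 a3 _ _] [d40 a4 _ _]] := (J3, J4).
have tn (p : {poly rat}) : p.[1] != 0 -> (FracField.tofrac p : Qq) != 0.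
  by rewrite tofrac_eq0; apply: contra_neq => ->; rewrite horner0.
set N := (n1 * d3 - n3 * d1) * (n2 * d4 - n4 * d2).
set D := (n1 * d4 - n4 * d1) * (n2 * d3 - n3 * d2).
have crE : cr_q F x1 x2 x3 x4 = FracField.tofrac N / FracField.tofrac D.
  rewrite /cr_q /qrat_fin FE1 FE2 FE3 FE4 /p1_ratio.
  rewrite (negPf (tn _ d10)) (negPf (tn _ d20)).
  rewrite (negPf (tn _ d30)) (negPf (tn _ d40)).
  rewrite [LHS](cr_ratio _ _ _ _ (tn _ d10) (tn _ d20) (tn _ d30) (tn _ d40)).
  by rewrite /N /D !rmorphM !rmorphB !rmorphM.
have N0 : N.[1] != 0 by rewrite hornerM mulf_neq0.
have D0 : D.[1] != 0 by rewrite hornerM mulf_neq0.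
(* Evaluating the fraction N/D at e^h requires D(e^h) to be nonzero, which holds near h = 0. *)
have near : \forall h \near (0 : R), @cr_exp R F x1 x2 x3 x4 h
    = horner_exp N h / horner_exp D h.
  have := @horner_exp_near0 R _ D0; apply: filterS => h Dh.
  by rewrite /cr_exp crE Qq_evalE.
have c0E : ratr (cr x1 x2 x3 x4) = @cr_exp R F x1 x2 x3 x4 0.
  rewrite (nbhs_singleton near) !horner_exp0 -fmorph_div; congr ratr.
  have xE n d (x : rat) : d.[1] != 0 -> n.[1] = x * d.[1] -> x = n.[1] / d.[1].
    by move=> dn ->; rewrite mulfK.
  rewrite (xE _ _ _ d10 a1) (xE _ _ _ d20 a2) (xE _ _ _ d30 a3) (xE _ _ _ d40 a4).
  by rewrite cr_ratio // /N /D !(hornerD, hornerN, hornerM).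
rewrite c0E /cr_deriv.
rewrite (derive2_quotient_exp N0 D0 near) !dlog2M // l13 l24 l14 l23.
have -> : 1 / 2 = ratr (1 / 2) :> R by rewrite fmorph_div rmorph1 rmorph_nat.
rewrite -rmorphM; congr ratr.
(* In the alternating sum over 13, 24, 14, 23 each [dlog2] of a d_i, each [inv_denq2] and the
   constant 11/24 cancel. *)
have := jet_termE x13; have := jet_termE x24.
have := jet_termE x14; have := jet_termE x23.
move: (jet_term x1 x3) (jet_term x2 x4) (jet_term x1 x4) (jet_term x2 x3).
move: (Phi x1 x3) (Phi x2 x4) (Phi x1 x4) (Phi x2 x3).
move: (inv_denq2 x1) (inv_denq2 x2) (inv_denq2 x3) (inv_denq2 x4).
move: (dlog2 d1) (dlog2 d2) (dlog2 d3) (dlog2 d4).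
clear => *; lra.
Qed.
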